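(* Let $(Z^{\bullet,j},d^{\bullet,j})$, $S^{i,j}$, $K^{i,j}$ be as described in the context, with associated complexes $(Y^\bullet,d^\bullet)$ and $(Y^\bullet,d_V^\bullet)$, $d_V=d-S$, and $F^i=\exp(K^i)$. Suppose that $P^i:Y^i\to Y^{i-1}$ are linear maps such that $d^{i-1}P^i+P^{i+1}d^i=I-L^i$ for all $i$, where $L^i:Y^i\to Y^i$ are linear maps. Define $\tilde P_V^i:=F^{i-1}\circ P^i\circ(F^i)^{-1}:Y^i\to Y^{i-1}$ and $L_V^i:=F^iL^i(F^i)^{-1}$. Then $$d_V^{i-1}\tilde P_V^i+\tilde P_V^{i+1}d_V^i=I-L_V^i\quad\text{for all } i.$$ If each $P^i$ is bounded, then each $\tilde P_V^i$ is bounded. If $P^{i-1}\circ P^i=0$ for all $i$, then $\tilde P_V^{i-1}\circ\tilde P_V^i=0$ for all $i$. If $L^i$ has finite rank, then so does $L_V^i$. If $dL=Ld=0$ (i.e. $d^iL^i=0$ and $L^{i+1}d^i=0$ for all $i$), then also $d_VL_V=L_Vd_V=0$.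
   Context: For $0\le i\le n$, $0\le j\le N$ let $Z^{i,j}$ be Hilbert spaces; spaces with indices out of range, and operators from or to them, are zero. Let $d^{i,j}:Z^{i,j}\to Z^{i+1,j}$ be bounded linear operators with $d^{i+1,j}d^{i,j}=0$, and let $S^{i,j}:Z^{i,j}\to Z^{i+1,j-1}$ be bounded linear operators with $d^{i+1,j-1}S^{i,j}=-S^{i+1,j}d^{i,j}$ and $S^{i+1,j-1}S^{i,j}=0$. Let $K^{i,j}:Z^{i,j}\to Z^{i,j-1}$ be bounded linear operators with $S^{i,j}=d^{i,j-1}K^{i,j}-K^{i+1,j}d^{i,j}$ and $S^{i,j-1}K^{i,j}=K^{i+1,j-1}S^{i,j}$ for all $i,j$. Put $Y^i=Z^{i,0}\times\cdots\times Z^{i,N}$; $d^i:Y^i\to Y^{i+1}$ acts componentwise, $S^i:Y^i\to Y^{i+1}$ is $S^i(u_0,\dots,u_N)=(S^{i,1}u_1,\dots,S^{i,N}u_N,0)$, and similarly $K^i:Y^i\to Y^i$ is $K^i(u_0,\dots,u_N)=(K^{i,1}u_1,\dots,K^{i,N}u_N,0)$, which is nilpotent. The twisted differential is $d_V^i=d^i-S^i$, and $F^i:=\exp(K^i)$ (a finite sum) is a bounded invertible operator on $Y^i$. *)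

(* Defs.v *)
From HB Require Import structures.
From mathcomp Require Import all_boot all_order all_algebra ring lra.
From mathcomp Require Import complex.
From mathcomp Require Import all_classical reals topology normedtype.

Set Implicit Arguments.
Unset Strict Implicit.
Unset Printing Implicit Defensive.

Import Order.TTheory GRing.Theory Num.Theory.
Import numFieldNormedType.Exports.

Local Open Scope classical_set_scope.
Local Open Scope ring_scope.

Inductive scalar_kind := RealScalars | ComplexScalars.

Definition scalar (R : realType) (k : scalar_kind) : numFieldType :=
  match k with RealScalars => R | ComplexScalars => R[i] end.

Definition scalar_conj (R : realType) (k : scalar_kind) :
    scalar R k -> scalar R k :=
  match k with RealScalars => idfun | ComplexScalars => fun z : R[i] => z^* end.

(** In MathComp a norm takes its values in the scalar field, so the square root
    needed by the norm of a Hilbert product is taken there too. *)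
Definition scalar_sqrt (R : realType) (k : scalar_kind) :
    scalar R k -> scalar R k :=
  match k with
  | RealScalars => fun x : R => Num.sqrt x
  | ComplexScalars => fun z : R[i] => sqrtC z
  end.

(** The inner product is linear in its first argument. *)
HB.mixin Record CompleteNormedModule_isHilbert (R : realType) (k : scalar_kind)
    V & CompleteNormedModule (scalar R k) V := {
  inner : {dot V for @scalar_conj R k};
  normr_sqr_inner : forall x : V, `|x| ^+ 2 = inner x x
}.

#[short(type="hilbertType")]
HB.structure Definition Hilbert (R : realType) (k : scalar_kind) :=
  {V of CompleteNormedModule (scalar R k) V
      & CompleteNormedModule_isHilbert R k V}.

Definition bounded_operator (K : numFieldType) (V W : normedModType K)
    (f : V -> W) : Prop :=
  linear f /\ exists M : K, forall x, `|f x| <= M * `|x|.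

Definition finite_rank (K : numFieldType) (V W : lmodType K) (f : V -> W) :
    Prop :=
  exists (m : nat) (b : 'I_m -> W),
    range f = range (fun c : 'I_m -> K => \sum_(l < m) c l *: b l).

Lemma scalar_sqrt_ge0 (R : realType) (k : scalar_kind) (x : scalar R k) :
  0 <= x -> 0 <= scalar_sqrt x.
Proof. by case: k x => x x0 /=; rewrite ?sqrtr_ge0 ?sqrtC_ge0. Qed.

Lemma sqr_scalar_sqrt (R : realType) (k : scalar_kind) (x : scalar R k) :
  0 <= x -> scalar_sqrt x ^+ 2 = x.
Proof. by case: k x => x x0 /=; [exact: sqr_sqrtr|exact: sqrtCK]. Qed.

Lemma sum_mul_le (F : numFieldType) (m : nat) (a b : 'I_m -> F) (s t : F) :
  (forall j, 0 <= a j) -> (forall j, 0 <= b j) -> 0 <= s -> 0 <= t ->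
  \sum_j a j ^+ 2 = s ^+ 2 -> \sum_j b j ^+ 2 = t ^+ 2 ->
  \sum_j a j * b j <= s * t.
Proof.
move=> a0 b0 s0 t0 sa tb.
have nul (c e : 'I_m -> F) r : (forall j, 0 <= c j) ->
    \sum_j c j ^+ 2 = r ^+ 2 -> r = 0 -> \sum_j c j * e j = 0.
  move=> c0 cr r0; move/eqP: cr; rewrite r0 expr0n /= psumr_eq0; last first.
    by move=> j _; rewrite exprn_ge0.
  move=> /allP cz; apply: big1 => j _.
  have := cz j (mem_index_enum j); rewrite /= sqrf_eq0 => /eqP ->.
  by rewrite mul0r.
have [s_0|sN0] := eqVneq s 0; first by rewrite (nul a b s) // s_0 mul0r.
have [t_0|tN0] := eqVneq t 0.
  under eq_bigr do rewrite mulrC.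
  by rewrite (nul b a t) // t_0 mulr0.
have st : 0 < s * t by rewrite mulr_gt0 // lt_def ?sN0 ?tN0.
have : 0 <= \sum_j (t * a j - s * b j) ^+ 2.
  apply: sumr_ge0 => j _; apply: real_exprn_even_ge0 => //.
  by apply: rpredB; apply: rpredM; exact: ger0_real.
have -> : \sum_j (t * a j - s * b j) ^+ 2 =
    t ^+ 2 * \sum_j a j ^+ 2 + s ^+ 2 * \sum_j b j ^+ 2
      - (2 * (s * t)) * \sum_j a j * b j.
  rewrite !mulr_sumr -big_split /= -sumrB; apply: eq_bigr => j _; ring.
rewrite sa tb.
have -> : t ^+ 2 * s ^+ 2 + s ^+ 2 * t ^+ 2 = (2 * (s * t)) * (s * t) by ring.
have c0 : 0 < 2 * (s * t) by rewrite pmulr_rgt0.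
by rewrite -mulrBr (pmulr_rge0 _ c0) subr_ge0.
Qed.

Section HilbertProduct.
Variables (R : realType) (k : scalar_kind) (m : nat).
Variable Z : 'I_m -> hilbertType R k.

Definition hprod : Type := forall j : 'I_m, Z j.

HB.instance Definition _ := gen_eqMixin hprod.
HB.instance Definition _ := gen_choiceMixin hprod.

Implicit Types u v w : hprod.

Let hadd u v : hprod := fun j => u j + v j.
Let hopp u : hprod := fun j => - u j.
Let hzero : hprod := fun=> 0.
Let hscale (a : scalar R k) u : hprod := fun j => a *: u j.

Let haddA : associative hadd.
Proof. by move=> u v w; apply: functional_extensionality_dep => j; exact: addrA. Qed.
Let haddC : commutative hadd.
Proof. by move=> u v; apply: functional_extensionality_dep => j; exact: addrC. Qed.
Let hadd0 : left_id hzero hadd.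
Proof. by move=> u; apply: functional_extensionality_dep => j; exact: add0r. Qed.
Let haddN : left_inverse hzero hopp hadd.
Proof. by move=> u; apply: functional_extensionality_dep => j; exact: addNr. Qed.

HB.instance Definition _ := GRing.isZmodule.Build hprod haddA haddC hadd0 haddN.

Let hscaleA a b u : hscale a (hscale b u) = hscale (a * b) u.
Proof. by apply: functional_extensionality_dep => j; exact: scalerA. Qed.
Let hscale1 : left_id 1 hscale.
Proof. by move=> u; apply: functional_extensionality_dep => j; exact: scale1r. Qed.
Let hscaleDr : right_distributive hscale +%R.
Proof. by move=> a u v; apply: functional_extensionality_dep => j; exact: scalerDr. Qed.
Let hscaleDl u : {morph hscale^~ u : a b / a + b}.
Proof. by move=> a b; apply: functional_extensionality_dep => j; exact: scalerDl. Qed.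

HB.instance Definition _ := GRing.Zmodule_isLmodule.Build (scalar R k) hprod
  hscaleA hscale1 hscaleDr hscaleDl.

Definition hprod_norm (u : hprod) : scalar R k :=
  scalar_sqrt (\sum_(j < m) `|u j| ^+ 2).

Let sum_ge0 u : 0 <= \sum_(j < m) `|u j| ^+ 2.
Proof. by apply: sumr_ge0 => j _; rewrite exprn_ge0. Qed.

Let norm_ge0 u : 0 <= hprod_norm u.
Proof. exact/scalar_sqrt_ge0/sum_ge0. Qed.

Let norm_sqr u : hprod_norm u ^+ 2 = \sum_(j < m) `|u j| ^+ 2.
Proof. exact/sqr_scalar_sqrt/sum_ge0. Qed.

Let norm_triangle u v : hprod_norm (u + v) <= hprod_norm u + hprod_norm v.
Proof.
rewrite -(ler_pXn2r (n := 2)) ?nnegrE ?addr_ge0 ?norm_ge0 // norm_sqr.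
have le1 : \sum_(j < m) `|(u + v) j| ^+ 2 <= \sum_(j < m) (`|u j| + `|v j|) ^+ 2.
  apply: ler_sum => j _; rewrite ler_pXn2r ?nnegrE ?addr_ge0 //.
  exact: ler_normD.
apply: le_trans le1 _; rewrite sqrrD !norm_sqr.
under eq_bigr do rewrite sqrrD.
rewrite !big_split /= lerD2r lerD2l.
rewrite -[X in X <= _]mulr2n lerMn2r /=.
by apply: sum_mul_le => //; rewrite norm_sqr.
Qed.

Let norm_scale (a : scalar R k) u : hprod_norm (a *: u) = `|a| * hprod_norm u.
Proof.
apply/eqP; rewrite -(eqrXn2 (n := 2)) ?mulr_ge0 ?norm_ge0 //; apply/eqP.
rewrite exprMn !norm_sqr mulr_sumr; apply: eq_bigr => j _.
by rewrite -exprMn -normrZ.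
Qed.

Let norm_eq0 u : hprod_norm u = 0 -> u = 0.
Proof.
move=> u0; move/eqP: (norm_sqr u); rewrite u0 expr0n /= eq_sym psumr_eq0.
  move=> /allP z; apply: functional_extensionality_dep => j.
  have := z j (mem_index_enum j).
  by rewrite /= sqrf_eq0 normr_eq0 => /eqP.
by move=> j _; rewrite exprn_ge0.
Qed.

HB.instance Definition _ := Lmodule_isNormed.Build (scalar R k) hprod
  norm_triangle norm_scale norm_eq0.

End HilbertProduct.

(** [S i j] and [K i j] stand for $S^{i,j+1}$ and $K^{i,j+1}$; the operators
    leaving $Z^{i,0}$ have a zero target and are not represented. Likewise a map
    $P^{i+1} : Y^{i+1} \to Y^i$ is written [P i], and $P^0 = 0$ is left out. *)
Section TwistedComplex.
Variables (R : realType) (k : scalar_kind) (N : nat).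
Variable Z : nat -> nat -> hilbertType R k.

Definition Y (i : nat) : normedModType (scalar R k) :=
  hprod (fun j : 'I_N.+1 => Z i j).

Definition component (i : nat) (u : Y i) (j : nat) : Z i j :=
  match @idP (j < N.+1)%N with
  | ReflectT lt_j_N => u (Ordinal lt_j_N)
  | ReflectF _ => 0
  end.

Section Operators.
Variable d : forall i j, Z i j -> Z i.+1 j.
Variable S : forall i j, Z i j.+1 -> Z i.+1 j.
Variable K : forall i j, Z i j.+1 -> Z i j.

Definition dY (i : nat) (u : Y i) : Y i.+1 := fun j => d (u j).

Definition SY (i : nat) (u : Y i) : Y i.+1 := fun j => S (component u j.+1).

Definition KY (i : nat) (u : Y i) : Y i := fun j => K (component u j.+1).

Definition dV (i : nat) (u : Y i) : Y i.+1 := dY u - SY u.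

(** $\exp(K^i)$; the series stops at order [N] because [KY] lowers the index
    [j] by one, so that its power of order [N.+1] vanishes. *)
Definition F (i : nat) (u : Y i) : Y i :=
  \sum_(l < N.+1) (l`!%:R)^-1 *: iter l (@KY i) u.

Definition Finv (i : nat) : Y i -> Y i := 'pinv_(fun=> 0) setT (@F i).

Definition PV (P : forall i, Y i.+1 -> Y i) (i : nat) : Y i.+1 -> Y i :=
  @F i \o P i \o @Finv i.+1.

Definition LV (L : forall i, Y i -> Y i) (i : nat) : Y i -> Y i :=
  @F i \o L i \o @Finv i.

End Operators.

(** $D^{i-1} P^i + P^{i+1} D^i = I - L^i$ for all [i]; for [i = 0] the first term
    passes through the zero space $Y^{-1}$. *)
Definition homotopy_identity (D : forall i, Y i -> Y i.+1)
    (P : forall i, Y i.+1 -> Y i) (L : forall i, Y i -> Y i) : Prop :=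
  (forall u : Y 0, P 0%N (D 0%N u) = u - L 0%N u) /\
  (forall i (u : Y i.+1), D i (P i u) + P i.+1 (D i.+1 u) = u - L i.+1 u).

End TwistedComplex.

(* Main.v *)
(** The identities [d K - K d = S] and [S K = K S] give
    [d K^l = K^l d + l K^(l-1) S], hence [d exp(K) = exp(K) d + exp(K) S] and
    [(d - S) exp(K) = exp(K) d]: the isomorphism [exp(K)] conjugates the complex
    with differential [d] into the twisted one, and carries all the structure
    along. Boundedness of the inverse comes from the finite Neumann series of
    [I - exp(K)], which is nilpotent. *)
From HB Require Import structures.
Require Import Defs.
From mathcomp Require Import all_boot all_order all_algebra.
From mathcomp Require Import all_classical reals topology normedtype.

Set Implicit Arguments.
Unset Strict Implicit.
Unset Printing Implicit Defensive.

Import Order.TTheory GRing.Theory Num.Theory.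
Import numFieldNormedType.Exports.

Local Open Scope ring_scope.

Definition to_linear (R : nzRingType) (V W : lmodType R) (f : V -> W)
  (f_linear : linear f) : {linear V -> W} :=
  HB.pack f (GRing.isLinear.Build _ _ _ _ f f_linear).

(** * Exponentials of nilpotent maps and their inverses, as pure linear algebra *)

Section NilpotentExponential.
Variables (R : numFieldType) (N : nat).

(** The body repeats that of [F], so that [F K] is convertible to [nilexp N] applied to [KY K]. *)
Definition nilexp (V : lmodType R) (f : V -> V) (u : V) : V :=
  \sum_(l < N.+1) (l`!%:R)^-1 *: iter l f u.

Lemma iter_linear (V : lmodType R) (f : {linear V -> V}) l : linear (iter l f).
Proof. by elim: l => [//|l IHl] a u v /=; rewrite IHl linearP. Qed.

Lemma iter_linear0 (V : lmodType R) (f : {linear V -> V}) l : iter l f 0 = 0.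
Proof. by elim: l => //= l ->; rewrite linear0. Qed.

Section Intertwining.
Variables (V W : lmodType R) (f : {linear V -> V}) (g : {linear W -> W}).
Variables d s : {linear V -> W}.
Hypothesis df : forall u, d (f u) = g (d u) + s u.
Hypothesis sf : forall u, s (f u) = g (s u).
Hypothesis f_nil : forall u, iter N.+1 f u = 0.
Hypothesis g_nil : forall u, iter N.+1 g u = 0.

Lemma iter_intertwine l u : s (iter l f u) = iter l g (s u).
Proof. by elim: l => //= l <-; rewrite sf. Qed.

(** Moving [d] across each of the [l.+1] factors [f] leaves one term in [s]; since [s] intertwines
    [f] with [g], each of these terms equals [g^l s]. *)
Lemma iter_commutator l u :
  d (iter l.+1 f u) = iter l.+1 g (d u) + l.+1%:R *: iter l g (s u).
Proof.
elim: l => [|l IHl]; first by rewrite /= df scale1r.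
rewrite iterS df IHl iter_intertwine linearD linearZ /= -addrA.
by rewrite -[X in _ *: _ + X]scale1r -scalerDl natr1.
Qed.

(* The commutator identity at order [N.+1] reads [0 = N.+1 *: g^N s]. *)
Lemma iter_top u : iter N g (s u) = 0.
Proof.
have /eqP := iter_commutator N u.
rewrite f_nil g_nil linear0 add0r eq_sym scaler_eq0 pnatr_eq0 /=.
by move/eqP.
Qed.

Lemma nilexp_intertwine u : d (nilexp f u) - s (nilexp f u) = nilexp g (d u).
Proof.
apply/eqP; rewrite subr_eq; apply/eqP; rewrite /nilexp !linear_sum.
(* The term of order [N] of the [s] sum is zero by [iter_top]. Its orders 0 to [N - 1] then pair
   with the orders 1 to [N] of the two other sums, because [l.+1 / l.+1! = 1 / l!]. *)
rewrite [X in _ = _ + X]big_ord_recr /= linearZ /= iter_intertwine iter_top.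
rewrite scaler0 addr0 big_ord_recl [X in _ = X + _]big_ord_recl.
rewrite !linearZ /= -addrA; congr (_ + _); rewrite -big_split /=.
apply: eq_bigr => l _; rewrite -[bump 0 l]/l.+1 add0n !linearZ /= -iterS.
rewrite iter_commutator scalerDr; congr (_ + _).
rewrite iter_intertwine scalerA factS natrM.
by rewrite invfM mulrC mulrA mulfV ?mul1r // pnatr_eq0.
Qed.

End Intertwining.

Section Neumann.
Variables (V : lmodType R) (h : {linear V -> V}) (m : nat).
Hypothesis h_nil : forall u, iter m (idfun \- h) u = 0.

Definition neumann (u : V) : V := \sum_(l < m) iter l (idfun \- h) u.

(** The sum collapses to [u - (1 - h)^m u]. Each summand is both [h (1 - h)^l u] and
    [(1 - h)^l h u], so this one identity yields the two cancellation laws. *)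
Let telescope u :
  \sum_(l < m) (iter l (idfun \- h) u - iter l.+1 (idfun \- h) u) = u.
Proof.
rewrite -[RHS]subr0 -[in RHS](h_nil u) -[RHS]opprB.
rewrite -(telescope_sumr (fun l => iter l (idfun \- h) u) (leq0n m)).
by rewrite big_mkord -sumrN; apply: eq_bigr => l _; rewrite opprB.
Qed.

Lemma neumannK : cancel neumann h.
Proof.
move=> u; rewrite -[RHS]telescope /neumann linear_sum; apply: eq_bigr => l _.
by rewrite /= subKr.
Qed.

Lemma neumannVK : cancel h neumann.
Proof.
move=> u; rewrite -[RHS]telescope; apply: eq_bigr => l _.
(* The extra factor is taken innermost and [h u] is written as [u - (u - h u)], so that linearity of
   the iterate concludes. *)
rewrite iterSr -[X in iter l _ X = _](subKr u).
exact: (linearB (to_linear (iter_linear _ l))).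
Qed.

End Neumann.

(** The constant term cancels in [1 - exp(f)], so every remaining term contains a factor [f]. Each
    application of [1 - exp(f)] to a vector thus lowers by one the power of [f] needed to kill
    it. *)
Lemma nilexp_unipotent (V : lmodType R) (f : {linear V -> V}) :
  (forall u, iter N.+1 f u = 0) ->
  forall u, iter N.+1 (idfun \- nilexp f) u = 0.
Proof.
move=> f_nil u.
have step m v : iter m.+1 f v = 0 -> iter m f ((idfun \- nilexp f) v) = 0.
  move=> fv0; rewrite /= /nilexp big_ord_recl /= fact0 invr1 scale1r.
  rewrite opprD addrA subrr add0r -sumrN.
  rewrite -[iter m f _]/(to_linear (iter_linear f m) _).
  rewrite linear_sum; apply: big1 => l _; rewrite linearN linearZ /=.
  rewrite add0n -iterSr -iterD addnC iterD fv0 iter_linear0.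
  by rewrite scaler0 oppr0.
have : forall m v, iter m f v = 0 -> iter m (idfun \- nilexp f) v = 0.
  by elim=> [//|m IHm] v /step /IHm; rewrite iterSr.
by apply; exact: f_nil.
Qed.

End NilpotentExponential.

(** * Stability properties of bounded operators *)

Section BoundedOperators.
Variable R : numFieldType.
Implicit Types V W X : normedModType R.

(** The constant in [bounded_operator] carries no sign; a nonnegative one is what lets two bounds be
    multiplied in a composition. *)
Lemma bounded_operatorP V W (f : V -> W) :
  bounded_operator f <->
  linear f /\ exists2 M : R, 0 <= M & forall x, `|f x| <= M * `|x|.
Proof.
split=> [[f_linear [M fM]]|[f_linear [M _ fM]]]; split=> //; last by exists M.
(* On a zero space [M] may be any scalar, even a non-real one. Still, [M * |x|] dominates a norm, so
   it equals its own absolute value [|M| * |x|]. *)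
exists `|M| => // x; apply: le_trans (fM x) _.
have /ger0_norm <- : 0 <= M * `|x| by apply: le_trans (fM x).
by rewrite normrM normr_id.
Qed.

Lemma bounded_operator0 V W (f : V -> W) : bounded_operator f -> f 0 = 0.
Proof. by move=> [f_linear _]; exact: (linear0 (to_linear f_linear)). Qed.

Lemma bounded_operator_zero V W : bounded_operator (fun _ : V => 0 : W).
Proof.
split=> [a x y|]; first by rewrite scaler0 addr0.
by exists 0 => x; rewrite normr0 mul0r.
Qed.

Lemma bounded_operator_id V : bounded_operator (@id V).
Proof. by split=> //; exists 1 => x; rewrite mul1r. Qed.

Lemma bounded_operator_comp V W X (g : W -> X) (f : V -> W) :
  bounded_operator g -> bounded_operator f -> bounded_operator (g \o f).
Proof.
move=> /bounded_operatorP[gl [M M0 gM]] /bounded_operatorP[fl [L L0 fL]].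
split=> [a x y|]; first by rewrite /= fl gl.
exists (M * L) => x /=; apply: le_trans (gM _) _.
by rewrite -mulrA ler_wpM2l.
Qed.

Lemma bounded_operator_add V W (f g : V -> W) :
  bounded_operator f -> bounded_operator g ->
  bounded_operator (fun x => f x + g x).
Proof.
move=> [fl [M fM]] [gl [L gL]]; split=> [a x y|].
  by rewrite fl gl scalerDr addrACA.
by exists (M + L) => x; rewrite mulrDl (le_trans (ler_normD _ _)) ?lerD.
Qed.

Lemma bounded_operator_scale V W (c : R) (f : V -> W) :
  bounded_operator f -> bounded_operator (fun x => c *: f x).
Proof.
move=> [fl [M fM]]; split=> [a x y|].
  by rewrite fl scalerDr !scalerA mulrC.
by exists (`|c| * M) => x; rewrite normrZ -mulrA ler_wpM2l.
Qed.

Lemma bounded_operator_sub V W (f g : V -> W) :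
  bounded_operator f -> bounded_operator g ->
  bounded_operator (fun x => f x - g x).
Proof.
move=> fb gb; under eq_fun do rewrite -scaleN1r.
exact/bounded_operator_add/bounded_operator_scale.
Qed.

Lemma bounded_operator_sum V W (I : Type) (r : seq I) (f : I -> V -> W) :
  (forall i, bounded_operator (f i)) ->
  bounded_operator (fun x => \sum_(i <- r) f i x).
Proof.
move=> fb; elim: r => [|i r IHr].
  by under eq_fun do rewrite big_nil; exact: bounded_operator_zero.
by under eq_fun do rewrite big_cons; exact: bounded_operator_add.
Qed.

Lemma bounded_operator_iter V (f : V -> V) l :
  bounded_operator f -> bounded_operator (iter l f).
Proof.
move=> fb; elim: l => [|l IHl]; first exact: bounded_operator_id.
exact: bounded_operator_comp.
Qed.

Lemma bounded_operator_nilexp N V (f : V -> V) :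
  bounded_operator f -> bounded_operator (nilexp N f).
Proof.
move=> fb; apply: bounded_operator_sum => l.
exact/bounded_operator_scale/bounded_operator_iter.
Qed.

Lemma bounded_operator_neumann m V (h : {linear V -> V}) :
  bounded_operator h -> bounded_operator (neumann h m).
Proof.
move=> hb; apply: bounded_operator_sum => l; apply: bounded_operator_iter.
exact: bounded_operator_sub (bounded_operator_id V) hb.
Qed.

End BoundedOperators.

(** * Boundedness into and out of a Hilbert product *)

Section HilbertProduct.
Variables (R : realType) (k : scalar_kind) (m : nat).
Variable Z : 'I_m -> hilbertType R k.

Lemma sqr_norm_hprod (u : hprod Z) : `|u| ^+ 2 = \sum_j `|u j| ^+ 2.
Proof.
by apply: sqr_scalar_sqrt; apply: sumr_ge0 => j _; rewrite exprn_ge0.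
Qed.

Lemma bounded_operator_proj (j : 'I_m) :
  bounded_operator (fun u : hprod Z => u j).
Proof.
split=> //; exists 1 => u; rewrite mul1r -(ler_pXn2r (n := 2)) ?nnegrE //.
rewrite sqr_norm_hprod (bigD1 j) //= lerDl sumr_ge0 // => i _.
by rewrite exprn_ge0.
Qed.

(** After squaring, it suffices that each [|u j|^2] is at most [|u j|] times the whole sum. This
    comparison allows the bounds of the components simply to be added. *)
Lemma norm_hprod_le_sum (u : hprod Z) : `|u| <= \sum_j `|u j|.
Proof.
have s0 : 0 <= \sum_j `|u j| by exact: sumr_ge0.
rewrite -(ler_pXn2r (n := 2)) ?nnegrE // sqr_norm_hprod expr2 mulr_suml.
apply: ler_sum => j _; rewrite expr2 ler_wpM2l // (bigD1 j) //= lerDl.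
exact: sumr_ge0.
Qed.

Lemma bounded_operator_hprod (V : normedModType (Defs.scalar R k))
    (f : V -> hprod Z) :
  (forall j, bounded_operator (fun x => f x j)) -> bounded_operator f.
Proof.
move=> fb; split=> [a x y|].
  by apply: functional_extensionality_dep => j; exact: (fb j).1.
have [M fM] := choice (fun j => (fb j).2).
exists (\sum_j M j) => x; apply: le_trans (norm_hprod_le_sum _) _.
by rewrite mulr_suml; apply: ler_sum => j _; exact: fM.
Qed.

End HilbertProduct.

(** [finite_rank] asks that the range equal a finite span. The right inverse [g'] makes [g]
    surjective, so [f \o g] has the full range of [f], and [h] carries the spanning family along. *)
Lemma finite_rank_conj (K : numFieldType) (V W V' W' : lmodType K)
    (f : V -> W) (h : {linear W -> W'}) (g : V' -> V) (g' : V -> V') :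
  cancel g' g -> finite_rank f -> finite_rank (h \o f \o g).
Proof.
move=> g'K [m [b fb]]; exists m, (h \o b).
have fE x : exists c : 'I_m -> K, \sum_(l < m) c l *: b l = f x.
  have : range f (f x) by exists x.
  by rewrite fb => -[c _ <-]; exists c.
apply/seteqP; split=> [_ [x _ <-] | _ [c _ <-]] /=.
  have [c fxE] := fE (g x); exists c => //.
  by rewrite -fxE linear_sum; apply: eq_bigr => l _; rewrite linearZ.
have : range (fun c : 'I_m -> K => \sum_(l < m) c l *: b l)
  (\sum_(l < m) c l *: b l) by exists c.
rewrite -fb => -[x _ fxE]; exists (g' x) => //=.
by rewrite g'K fxE linear_sum; apply: eq_bigr => l _; rewrite linearZ.
Qed.

(** * The operators on the product spaces, component by component *)

Section TwistedComplex.
Variables (R : realType) (k : scalar_kind) (N : nat).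
Variable Z : nat -> nat -> hilbertType R k.
Local Notation Y := (Y N Z).

Lemma component_ord i (u : Y i) (j : 'I_N.+1) : component u j = u j.
Proof.
case: j => j ltj; rewrite /component /=.
destruct (@idP (j < N.+1)%N) as [lt_j|].
  by rewrite (bool_irrelevance lt_j ltj).
by [].
Qed.

Lemma component_out i (u : Y i) j : (N < j)%N -> component u j = 0.
Proof.
rewrite /component => Nj.
destruct (@idP (j < N.+1)%N) as [lt_j|]; last by [].
by have := lt_j; rewrite ltnNge Nj.
Qed.

Lemma component_inj i (u v : Y i) :
  (forall j, component u j = component v j) -> u = v.
Proof.
move=> uv; apply: functional_extensionality_dep => j.
by rewrite -!component_ord.
Qed.

Lemma componentD i (u v : Y i) j :
  component (u + v) j = component u j + component v j.
Proof.
rewrite /component; destruct (@idP (j < N.+1)%N); first by [].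
by rewrite addr0.
Qed.

Lemma bounded_operator_component i j :
  bounded_operator (fun u : Y i => component u j).
Proof.
rewrite /component; destruct (@idP (j < N.+1)%N) as [lt_j|].
  exact: (bounded_operator_proj (fun j : 'I_N.+1 => Z i j) (Ordinal lt_j)).
exact: bounded_operator_zero.
Qed.

Section Operators.
Variable d : forall i j, Z i j -> Z i.+1 j.
Hypothesis d_bounded : forall i j, bounded_operator (@d i j).
Variable S : forall i j, Z i j.+1 -> Z i.+1 j.
Hypothesis S_bounded : forall i j, bounded_operator (@S i j).
Variable K : forall i j, Z i j.+1 -> Z i j.
Hypothesis K_bounded : forall i j, bounded_operator (@K i j).

Lemma bounded_operator_dY i : bounded_operator (@dY R k N Z d i).
Proof.
apply: bounded_operator_hprod => j.
exact: bounded_operator_comp (d_bounded i j) (bounded_operator_proj _ j).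
Qed.

Lemma bounded_operator_SY i : bounded_operator (@SY R k N Z S i).
Proof.
apply: bounded_operator_hprod => j.
apply: bounded_operator_comp (S_bounded i j) _.
exact: bounded_operator_component.
Qed.

Lemma bounded_operator_KY i : bounded_operator (@KY R k N Z K i).
Proof.
apply: bounded_operator_hprod => j.
apply: bounded_operator_comp (K_bounded i j) _.
exact: bounded_operator_component.
Qed.

Lemma bounded_operator_F i : bounded_operator (F K (i := i) : Y i -> Y i).
Proof. exact/bounded_operator_nilexp/bounded_operator_KY. Qed.

Hypothesis S_dK : forall i j (z : Z i j.+1),
  S z = d (K z) - K (d z).
Hypothesis SK : forall i j (z : Z i j.+2), S (K z) = K (S z).

(** Common form of the formulas for [dY], [SY] and [KY], valid at every natural [j]: for [j > N] the
    index [h j] is out of range too, and both sides are zero. *)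
Lemma component_graded (a : nat -> nat) (h : nat -> nat)
    (f : forall i j, Z i (h j) -> Z (a i) j) i (u : Y i) j :
  (forall i j, bounded_operator (@f i j)) -> (forall j, j <= h j)%N ->
  component ((fun j : 'I_N.+1 => f i j (component u (h j))) : Y (a i)) j =
    f i j (component u (h j)).
Proof.
move=> fb hj; have [Nj|jN] := ltnP N j; last first.
  by rewrite (component_ord _ (Ordinal (jN : (j < N.+1)%N))).
rewrite !component_out ?(leq_trans Nj) //.
exact/esym/bounded_operator0.
Qed.

Lemma component_dY i (u : Y i) j : component (dY d u) j = d (component u j).
Proof.
have -> : dY d u = (fun j : 'I_N.+1 => d (component u j)) :> Y i.+1.
  by apply: functional_extensionality_dep => l; rewrite component_ord.
exact: (component_graded (h := id)).
Qed.

Lemma component_SY i (u : Y i) j : component (SY S u) j = S (component u j.+1).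
Proof. exact: component_graded. Qed.

Lemma component_KY i (u : Y i) j : component (KY K u) j = K (component u j.+1).
Proof. exact: (component_graded (a := id)). Qed.

Lemma KY_nilpotent i (u : Y i) : iter N.+1 (KY K (i := i)) u = 0.
Proof.
(* After [l] applications only the components [j <= N - l] can survive, hence none for
   [l = N.+1]. *)
have low l j : (N < l + j)%N -> component (iter l (KY K (i := i)) u) j = 0.
  elim: l j => [|l IHl] j Nlj; first exact: component_out.
  rewrite iterS component_KY IHl ?addnS //.
  exact: bounded_operator0.
apply: component_inj => j; rewrite low ?leq_addr //.
exact/esym/(bounded_operator0 (bounded_operator_component i j)).
Qed.

Let dY' i := to_linear (bounded_operator_dY i).1.
Let SY' i := to_linear (bounded_operator_SY i).1.
Let KY' i := to_linear (bounded_operator_KY i).1.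
Let F' i := to_linear (bounded_operator_F i).1.

(** Read on components, [S_dK] and [SK] are the two commutation hypotheses of [nilexp_intertwine],
    with [SY] in the role of [s]. *)
Lemma dV_F i (u : Y i) : dV d S (F K u) = F K (dY d u).
Proof.
apply: (nilexp_intertwine (f := KY' i) (g := KY' i.+1) (d := dY' i)
  (s := SY' i)) => [v|v|v|v]; try exact: KY_nilpotent.
- apply: component_inj => j; rewrite componentD component_dY !component_KY.
  by rewrite component_SY component_dY S_dK addrC subrK.
- by apply: component_inj => j; rewrite !(component_KY, component_SY) SK.
Qed.

Let F_nilpotent i (u : Y i) : iter N.+1 (idfun \- F' i) u = 0.
Proof. by apply: (nilexp_unipotent (f := KY' i)); exact: KY_nilpotent. Qed.

(** [Finv] is a chosen partial inverse, pinned down by the injectivity of [F] once [u] is written as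
    [F] of its Neumann sum. The explicit formula then gives both cancellations and the bound. *)
Lemma Finv_neumann i : Finv K (i := i) = neumann (F' i) N.+1.
Proof.
apply/funext => u; rewrite -{1}(neumannK (@F_nilpotent i) u).
apply: pinvKV; rewrite ?inE // => v w _ _.
exact: (can_inj (neumannVK (@F_nilpotent i))).
Qed.

Lemma F_Finv i : cancel (Finv K (i := i)) (F K (i := i) : Y i -> Y i).
Proof. by rewrite Finv_neumann; exact/neumannK/F_nilpotent. Qed.

Lemma Finv_F i : cancel (F K (i := i) : Y i -> Y i) (Finv K (i := i)).
Proof. by rewrite Finv_neumann; exact/neumannVK/F_nilpotent. Qed.

Lemma bounded_operator_Finv i :
  bounded_operator (Finv K (i := i) : Y i -> Y i).
Proof.
by rewrite Finv_neumann; exact/bounded_operator_neumann/bounded_operator_F.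
Qed.

End Operators.
End TwistedComplex.

(** * Transport of homotopies along the exponential *)

Theorem proposition1 (R : realType) (k : scalar_kind) (n N : nat)
  (Z : nat -> nat -> hilbertType R k)
  (Z_out : forall i j, (n < i)%N || (N < j)%N -> forall z : Z i j, z = 0)
  (d : forall i j, Z i j -> Z i.+1 j)
  (d_bounded : forall i j, bounded_operator (@d i j))
  (dd : forall i j (z : Z i j), d i.+1 j (d i j z) = 0)
  (S : forall i j, Z i j.+1 -> Z i.+1 j)
  (S_bounded : forall i j, bounded_operator (@S i j))
  (dS : forall i j (z : Z i j.+1),
    d i.+1 j (S i j z) = - S i.+1 j (d i j.+1 z))
  (SS : forall i j (z : Z i j.+2), S i.+1 j (S i j.+1 z) = 0)
  (K : forall i j, Z i j.+1 -> Z i j)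
  (K_bounded : forall i j, bounded_operator (@K i j))
  (S_dK : forall i j (z : Z i j.+1),
    S i j z = d i j (K i j z) - K i.+1 j (d i j.+1 z))
  (SK : forall i j (z : Z i j.+2), S i j (K i j.+1 z) = K i.+1 j (S i j.+1 z))
  (P : forall i, {linear Y N Z i.+1 -> Y N Z i})
  (L : forall i, {linear Y N Z i -> Y N Z i})
  (dP : homotopy_identity (@dY R k N Z d) (fun i => P i) (fun i => L i)) :
  let d_V := @dV R k N Z d S in
  let P_V := PV K (fun i => P i) in
  let L_V := LV K (fun i => L i) in
  [/\ homotopy_identity d_V P_V L_V,
      (forall i, bounded_operator (P i)) ->
        forall i, bounded_operator (P_V i),
      (forall i (u : Y N Z i.+2), P i (P i.+1 u) = 0) ->
        forall i (u : Y N Z i.+2), P_V i (P_V i.+1 u) = 0,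
      forall i, finite_rank (L i) -> finite_rank (L_V i) &
      (forall i (u : Y N Z i), dY d (L i u) = 0 /\ L i.+1 (dY d u) = 0) ->
        forall i (u : Y N Z i),
          d_V i (L_V i u) = 0 /\ L_V i.+1 (d_V i u) = 0].
Proof.
move=> d_V P_V L_V.
have FV i : cancel (Finv K (i := i)) (F K (i := i) : Y N Z i -> Y N Z i).
  exact: F_Finv.
have VF i : cancel (F K (i := i) : Y N Z i -> Y N Z i) (Finv K (i := i)).
  exact: Finv_F.
have dVF i (u : Y N Z i) : d_V i (F K u) = F K (dY d u) by exact: dV_F.
have dYVF i (u : Y N Z i) : Finv K (d_V i u) = dY d (Finv K u).
  by rewrite -{1}(FV i u) dVF VF.
have Fb i : bounded_operator (F K (i := i) : Y N Z i -> Y N Z i).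
  exact: bounded_operator_F.
pose F' i := to_linear (Fb i).1.
have F0 i : F K (0 : Y N Z i) = 0 by exact: bounded_operator0.
have FD i (u v : Y N Z i) : F K (u + v) = F K u + F K v.
  exact: (linearD (F' i)).
have FB i (u v : Y N Z i) : F K (u - v) = F K u - F K v.
  exact: (linearB (F' i)).
split.
(* Each term is the conjugate by [F] of its untwisted counterpart, so [F] factors out and [dP]
   applies inside. Degree 0 has a single term on the left. *)
- split=> [u|i u]; rewrite /P_V /PV /L_V /LV /= dYVF.
    by rewrite dP.1 FB FV.
  by rewrite dVF -FD dP.2 FB FV.
- move=> Pb i.
  have Finvb : bounded_operator (Finv K (i := i.+1) : Y N Z _ -> _).
    exact: bounded_operator_Finv.
  exact: bounded_operator_comp (bounded_operator_comp (Fb i) (Pb i)) Finvb.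
- by move=> PP i u; rewrite /P_V /PV /= VF PP F0.
(* [F] serves as the right inverse of [Finv]. *)
- by move=> i; exact: (finite_rank_conj (F' i) (VF i)).
(* The two composites become [F d L F^-1] and [F L d F^-1]. *)
- move=> dL i u; rewrite /L_V /LV /= dVF dYVF.
  by rewrite (dL i _).1 (dL i _).2 !F0.
Qed.
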